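(* Let $a, b, c, n\in\mathbf{Z}$ with $n\geq 2$ and $a$ not divisible by $n$. Let $r=\gcd(a,n)$, let $k$ be the multiplicity of $2$ in $n/r$, and put $m=n/(2^k r)$, $\delta=\gcd(m,r)$, $d=b^2-4ac$. Then IQF is valid for $ax^2+bx+c\equiv 0 \bmod n$ if and only if either (a) $d$ is a quadratic non-residue of $n$, or (b) $d$ is a quadratic residue of $n$ and exactly one of the following mutually exclusive conditions holds: (i) there exists a prime factor $p$ of $2a$ such that, if $\beta$ is the multiplicity of $p$ in $2a$ and $\alpha$ is the multiplicity of $p$ in $4am$ when $k\in\{0,1,2\}$, respectively the multiplicity of $p$ in $2^k a m$ when $k\geq 3$, then $1<\beta<\alpha$, $b$ is divisible by $p$, $d$ is divisible by $p^2$, and $(p^{\alpha},p^{\beta})$ forms a $(b,d)$-obstruction; (ii) $k=0$, $b$ and $c$ are divisible by $r$, $d/r^2$ is a quadratic residue of $m$, and either $\delta=1$ or $\delta$ is the product of distinct odd primes $p_1,\dots,p_t$, each prime $p_i$ has even multiplicity $m_i$ in $m$, and $d/r^2$ is divisible by the product $p_1^{m_1}\cdots p_t^{m_t}$; (iii) $k=1$, $b$ and $c$ are divisible by $r$, $b/r$ is odd, either $a/r$ or $c/r$ is even, $d/r^2$ is a quadratic residue of $m$, and either $\delta=1$ or $\delta$ is the product of distinct odd primes $p_1,\dots,p_t$, each prime $p_i$ has even multiplicity $m_i$ in $m$, and $d/r^2$ is divisible by $p_1^{m_1}\cdots p_t^{m_t}$; (iv) $k\geq 3$, $r$ and $k$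 are odd, $b$ and $c$ are divisible by $r$, $k-1$ is the multiplicity of $2$ in $d/r^2$, $d/(r^2\cdot 2^{k-1})\equiv 1\bmod 8$, $d/r^2$ is a quadratic residue of $m$, and either $\delta=1$ or $\delta$ is the product of distinct odd primes $p_1,\dots,p_t$, each prime $p_i$ has even multiplicity $m_i$ in $m$, and $d/r^2$ is divisible by $p_1^{m_1}\cdots p_t^{m_t}$.
   Context: IQF (the intermediate form of the quadratic formula) is valid for $ax^2+bx+c\equiv 0\bmod n$, with $d=b^2-4ac$, if for every integer $x$: $ax^2+bx+c\equiv 0\bmod n$ if and only if there is an integer $s$ with $s^2\equiv d\bmod n$ and $2ax\equiv -b+s\bmod n$. An integer $u$ is a quadratic residue of a positive integer $v$ if $x^2\equiv u\bmod v$ has an integer solution (no coprimality is required; $v=1$ is allowed), and a quadratic non-residue of $v$ otherwise. The multiplicity of a prime $p$ in a nonzero integer $z$ is the largest $e\geq 0$ with $p^e\mid z$. (The integer $0$ has no finite multiplicity, so ''the multiplicity of $2$ in $z$ is $k-1$'' is false when $z=0$.) $(b,d)$-obstruction: let $p$ be a prime, $\alpha,\beta$ positive integers, $b,d$ integers. The pair $(p^{\alpha},p^{\beta})$ forms a $(b,d)$-obstruction if one of the following holds: (1) $d$ is not divisible by $p^{\alpha}$, the multiplicity of $p$ in $d$ is even, say $2\mu$, and, writing $d=d_1p^{2\mu}$ and letting $\Sigma$ be the set of all solutions $\sigma$, $0\leq\sigma<p^{\alpha-2\mu}$, of $x^2\equiv d_1\bmod p^{\alpha-2\mu}$, one has $\sigma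 p^{\mu}+ip^{\alpha-\mu}\not\equiv b\bmod p^{\beta}$ for all $\sigma\in\Sigma$ and all $i\in\{0,1,\dots,p^{\mu}-1\}$; (2) $d$ is divisible by $p^{\alpha}$ and, with $s$ chosen so that $\alpha=2s$ if $\alpha$ is even and $\alpha=2s-1$ if $\alpha$ is odd, one has $ip^{s}\not\equiv b\bmod p^{\beta}$ for all $i\in\{0,1,\dots,p^{\alpha-s}-1\}$. *)

(* Defs.v *)
From mathcomp Require Import all_boot all_order all_algebra.

Set Implicit Arguments.
Unset Strict Implicit.
Unset Printing Implicit Defensive.

Import Order.TTheory GRing.Theory Num.Theory.

Local Open Scope ring_scope.

Definition IQF_valid (a b c n : int) : Prop :=
  let d := b ^+ 2 - 4 * a * c in
  forall x : int,
    (a * x ^+ 2 + b * x + c = 0 %[mod n])%Z <->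
    exists s : int,
      (s ^+ 2 = d %[mod n])%Z /\ (2 * a * x = - b + s %[mod n])%Z.

Definition quadratic_residue (u v : int) : Prop :=
  exists x : int, (x ^+ 2 = u %[mod v])%Z.

Definition quadratic_nonresidue (u v : int) : Prop :=
  ~ quadratic_residue u v.

(* Meaningful for z != 0 only, since logn p 0 = 0: wherever z could vanish,
   z != 0 (or a non-divisibility that implies it) is required separately. *)
Definition multiplicity (p : nat) (z : int) : nat := logn p `|z|%N.

(* The subtraction alpha - 2 * mu is never truncated, because p ^ alpha does
   not divide d. *)
Definition obstruction1 (p alpha beta : nat) (b d : int) : Prop :=
  ~~ (p%:Z ^+ alpha %| d)%Z /\
  exists mu : nat,
    multiplicity p d = (2 * mu)%N /\
    let d1 := (d %/ p%:Z ^+ (2 * mu))%Z in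
    forall sigma : nat,
      (sigma < p ^ (alpha - 2 * mu))%N ->
      (sigma%:Z ^+ 2 = d1 %[mod p%:Z ^+ (alpha - 2 * mu)])%Z ->
      forall i : nat, (i < p ^ mu)%N ->
        (sigma%:Z * p%:Z ^+ mu + i%:Z * p%:Z ^+ (alpha - mu)
           <> b %[mod p%:Z ^+ beta])%Z.

(* uphalf alpha is the s with alpha = 2s (alpha even) or alpha = 2s - 1
   (alpha odd). *)
Definition obstruction2 (p alpha beta : nat) (b d : int) : Prop :=
  (p%:Z ^+ alpha %| d)%Z /\
  let s := uphalf alpha in
  forall i : nat, (i < p ^ (alpha - s))%N ->
    (i%:Z * p%:Z ^+ s <> b %[mod p%:Z ^+ beta])%Z.

(* (p ^ alpha, p ^ beta) forms a (b, d)-obstruction, for p prime and alpha,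
   beta positive. *)
Definition obstruction (p alpha beta : nat) (b d : int) : Prop :=
  obstruction1 p alpha beta b d \/ obstruction2 p alpha beta b d.

(* delta = 1, or delta is a product of distinct odd primes, each of even
   multiplicity in m, with the product of their full powers in m dividing D. *)
Definition delta_condition (delta m D : int) : Prop :=
  delta = 1 \/
  exists ps : seq nat,
    [/\ uniq ps,
        (forall p, p \in ps -> prime p /\ odd p),
        delta = \prod_(p <- ps) p%:Z,
        (forall p, p \in ps -> ~~ odd (multiplicity p m)) &
        ((\prod_(p <- ps) p%:Z ^+ multiplicity p m) %| D)%Z].

Definition condition_i (a b d m : int) (k : nat) : Prop :=
  exists p : nat,
    [/\ prime p, (p%:Z %| 2 * a)%Z &
      let beta := multiplicity p (2 * a) in
      let alpha := multiplicity p (if (k <= 2)%N then 4 * a * m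
                                   else 2 ^+ k * a * m) in
      [/\ (1 < beta < alpha)%N, (p%:Z %| b)%Z, (p%:Z ^+ 2 %| d)%Z &
          obstruction p alpha beta b d]].

Definition condition_ii (b c d r m delta : int) (k : nat) : Prop :=
  let D := (d %/ r ^+ 2)%Z in
  [/\ k = 0%N, (r %| b)%Z /\ (r %| c)%Z, quadratic_residue D m &
      delta_condition delta m D].

Definition condition_iii (a b c d r m delta : int) (k : nat) : Prop :=
  let D := (d %/ r ^+ 2)%Z in
  [/\ k = 1%N,
      (r %| b)%Z /\ (r %| c)%Z,
      ~~ (2 %| (b %/ r)%Z)%Z /\ ((2 %| (a %/ r)%Z)%Z \/ (2 %| (c %/ r)%Z)%Z),
      quadratic_residue D m &
      delta_condition delta m D].

Definition condition_iv (b c d r m delta : int) (k : nat) : Prop :=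
  let D := (d %/ r ^+ 2)%Z in
  [/\ (3 <= k)%N,
      ~~ (2 %| r)%Z /\ odd k,
      (r %| b)%Z /\ (r %| c)%Z,
      [/\ D != 0, multiplicity 2 D = k.-1 &
          ((d %/ (r ^+ 2 * 2 ^+ k.-1))%Z = 1 %[mod 8])%Z] &
      quadratic_residue D m /\ delta_condition delta m D].

Definition mutually_exclusive (Cs : seq Prop) : Prop :=
  forall i j : nat, nth False Cs i -> nth False Cs j -> i = j.

Definition exactly_one (Cs : seq Prop) : Prop :=
  exists! i : nat, nth False Cs i.

(* Main.v *)
Require Import Defs.
From mathcomp Require Import all_boot all_order all_algebra.
From mathcomp Require Import ring zify.
From Stdlib Require Import Classical_Prop.

(** Write f = a x^2 + b x + c, a = r a', n / r = 2^k m, and let M be m when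
    k <= 2 and 2^(k-2) m otherwise.  Since 4 a f(x) = (2ax + b)^2 - d and a' is
    prime to n / r, the right-hand side of IQF at x says n | 4 a f(x), that is
    M | f(x); so IQF is valid iff M | f(x) implies n | f(x) for all x.

    Either M | f(x) has no solution: by the Chinese remainder theorem this
    happens at a single prime p, and when d is a residue of n, solutions
    at p | 2a correspond to square roots y of d mod p^alpha with
    y = b mod p^beta, whose absence is the obstruction of (i).

    Or there is a solution x0.  If M-solutions are n-solutions, comparing x0 with
    x0 + M and x0 - M gives r | b, c, so f = r g with discriminant D = d / r^2.
    Completing the square, the question at each prime p becomes when
    p^v | r (z^2 - D) forces p^w | z^2 - D for all z.  Perturbing a solution z0 by
    a suitable power of p shows that this is as rigid as (ii)-(iv) say, and
    conversely these conditions let solutions lift. *)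

Set Implicit Arguments.
Unset Strict Implicit.
Unset Printing Implicit Defensive.

Import Order.TTheory GRing.Theory Num.Theory.

Local Open Scope ring_scope.

(** * Divisibility and multiplicities over the integers *)

Lemma eqmodz_dvd (q x y : int) : (x = y %[mod q])%Z <-> (q %| x - y)%Z.
Proof. by rewrite -eqz_mod_dvd; split=> [->|/eqP]. Qed.

Lemma dvdzDl (d x y : int) : (d %| x)%Z -> (d %| x + y)%Z = (d %| y)%Z.
Proof. exact: rpredDl. Qed.

Lemma dvdzDr (d x y : int) : (d %| y)%Z -> (d %| x + y)%Z = (d %| x)%Z.
Proof. exact: rpredDr. Qed.

Lemma dvdzN (d x : int) : (d %| - x)%Z = (d %| x)%Z.
Proof. exact: rpredN. Qed.

Lemma absz_expz (p e : nat) : `|p%:Z ^+ e|%N = (p ^ e)%N.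
Proof. by rewrite abszX absz_nat. Qed.

Lemma dvdz_pfactor (p e : nat) (z : int) : prime p -> z != 0 ->
  (p%:Z ^+ e %| z)%Z = (e <= multiplicity p z)%N.
Proof.
by move=> pp z0; rewrite dvdzE absz_expz pfactor_dvdn // absz_gt0.
Qed.

Lemma multiplicityM (p : nat) (x y : int) : x != 0 -> y != 0 ->
  multiplicity p (x * y) = (multiplicity p x + multiplicity p y)%N.
Proof. by move=> x0 y0; rewrite /multiplicity abszM lognM // absz_gt0. Qed.

Lemma multiplicityX (p e : nat) (x : int) :
  multiplicity p (x ^+ e) = (e * multiplicity p x)%N.
Proof. by rewrite /multiplicity abszX lognX. Qed.

Lemma multiplicityP (p : nat) (z : int) : prime p -> z != 0 ->
  exists2 w, z = p%:Z ^+ multiplicity p z * w & ~~ (p%:Z %| w)%Z.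
Proof.
move=> pp z0; have /dvdzP[w zE] : (p%:Z ^+ multiplicity p z %| z)%Z.
  by rewrite dvdz_pfactor.
exists w; first by rewrite mulrC.
apply/negP => /dvdzP[w' wE].
suff : (p%:Z ^+ (multiplicity p z).+1 %| z)%Z by rewrite dvdz_pfactor // ltnn.
by apply/dvdzP; exists w'; rewrite {1}zE wE exprS mulrA.
Qed.

Lemma dvdz_exp_sqr (p e : nat) (z : int) : prime p ->
  (p%:Z ^+ e %| z ^+ 2)%Z = (p%:Z ^+ uphalf e %| z)%Z.
Proof.
move=> pp; have [->|z0] := eqVneq z 0; first by rewrite expr0n !dvdz0.
rewrite !dvdz_pfactor ?expf_neq0 // multiplicityX leq_uphalf_double -muln2.
by rewrite mulnC.
Qed.

Lemma dvdz_prime_mul (p : nat) (x y : int) : prime p ->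
  (p%:Z %| x * y)%Z = (p%:Z %| x)%Z || (p%:Z %| y)%Z.
Proof. by move=> pp; rewrite !dvdzE abszM Euclid_dvdM. Qed.

Lemma coprime_prime_exp (p e : nat) (z : int) : prime p ->
  ~~ (p%:Z %| z)%Z -> coprimez (p%:Z ^+ e) z.
Proof.
move=> pp; rewrite dvdzE absz_nat -prime_coprime // coprimezE absz_expz.
exact: coprimeXl.
Qed.

Lemma dvdz_local (N z : int) : N != 0 ->
  (forall p : nat, prime p -> (p%:Z ^+ multiplicity p N %| z)%Z) -> (N %| z)%Z.
Proof.
move=> N0 H; rewrite dvdzE; apply/dvdn_partP; first by rewrite absz_gt0.
move=> p; rewrite mem_primes => /and3P[pp _ _].
by have := H p pp; rewrite dvdzE absz_expz p_part.
Qed.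

(** * Functions compatible with congruences; Chinese remaindering *)

Definition congr_fun (F : int -> int) :=
  forall q x y : int, (q %| x - y)%Z -> (q %| F x - F y)%Z.

Lemma congr_fun_dvd (F : int -> int) (q x y : int) : congr_fun F ->
  (q %| x - y)%Z -> (q %| F x)%Z = (q %| F y)%Z.
Proof.
by move=> cF /cF qF; rewrite -{1}[F x](subrK (F y)) dvdzDl.
Qed.

Definition quad (a b c x : int) : int := a * x ^+ 2 + b * x + c.

Lemma quad_complete_square (a b c x : int) :
  4 * a * quad a b c x = (2 * a * x + b) ^+ 2 - (b ^+ 2 - 4 * a * c).
Proof. by rewrite /quad; ring. Qed.

Lemma congr_quad (a b c : int) : congr_fun (quad a b c).
Proof.
move=> q x y /dvdzP[t xyE]; apply/dvdzP; rewrite /quad.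
exists (t * (a * (x + y) + b)).
by rewrite mulrAC -xyE; ring.
Qed.

Lemma chinese_dvd (q1 q2 x1 x2 : int) : coprimez q1 q2 ->
  exists x, (q1 %| x - x1)%Z /\ (q2 %| x - x2)%Z.
Proof.
move=> co; exists (zchinese q1 q2 x1 x2).
by split; apply/eqmodz_dvd; [exact: zchinese_modl | exact: zchinese_modr].
Qed.

Lemma linear_solve (A q t : int) : coprimez q A -> exists x, (q %| A * x - t)%Z.
Proof.
case/coprimezP => -[u v] /= uvE; exists (v * t); apply/dvdzP; exists (- u * t).
by rewrite -[X in _ - X]mul1r -uvE; ring.
Qed.

Lemma coprime_prime_prod (p e : nat) (s : seq nat) (f : nat -> nat) :
  prime p -> (forall q, q \in s -> prime q) -> p \notin s ->
  coprimez (p%:Z ^+ e) (\prod_(q <- s) q%:Z ^+ f q).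
Proof.
move=> pp; elim: s => [|q s IH] ps;
  first by rewrite big_nil coprimezE coprimen1.
rewrite inE negb_or => /andP[pq pNs]; rewrite big_cons coprimezMr IH ?andbT //.
  apply: coprime_prime_exp => //;
    rewrite dvdzE absz_expz absz_nat Euclid_dvdX //.
  by rewrite dvdn_prime2 ?(negbTE pq) // ps // mem_head.
by move=> x xs; apply: ps; rewrite inE xs orbT.
Qed.

(** Induction on the list of primes of [M]: a solution at the new prime [p] and one for the
    remaining primes are glued, and [congr_fun] carries divisibility over to the glued point. *)
Lemma chinese_solvable (F : int -> int) (M : int) : congr_fun F -> M != 0 ->
  (forall p : nat, prime p -> exists x, (p%:Z ^+ multiplicity p M %| F x)%Z) ->
  exists x, (M %| F x)%Z.
Proof.
move=> cF M0 H.
suff [x Hx] : exists x, forall p, p \in primes `|M| ->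
    (p%:Z ^+ multiplicity p M %| F x)%Z.
  exists x; apply: dvdz_local => // p pp.
  have [/Hx //|pM] := boolP (p \in primes `|M|).
  by rewrite /multiplicity lognE -mem_primes (negbTE pM) expr0 dvd1z.
have := primes_uniq `|M|.
have : forall p, p \in primes `|M| -> prime p.
  by move=> p; rewrite mem_primes => /and3P[].
elim: (primes _) => [|p s IH] ps /=; first by exists 0.
case/andP=> pNs us; have [|//|x Hx] := IH.
  by move=> q qs; apply: ps; rewrite inE qs orbT.
have pp : prime p by apply: ps; rewrite mem_head.
have [y Hy] := H p pp.
have [|t [t1 t2]] := @chinese_dvd (p%:Z ^+ multiplicity p M)
   (\prod_(q <- s) q%:Z ^+ multiplicity q M) y x.
  by apply: coprime_prime_prod => // q qs; apply: ps; rewrite inE qs orbT.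
exists t => q; rewrite inE => /orP[/eqP->|qs].
  by rewrite (congr_fun_dvd cF t1).
rewrite (congr_fun_dvd cF (_ : (_ %| t - x)%Z)) ?Hx //.
by apply: dvdz_trans t2; rewrite (big_rem q) //= dvdz_mulr.
Qed.

(** * Obstructions *)

Lemma expz_nat (p e : nat) : (p ^ e)%N%:Z = p%:Z ^+ e.
Proof. by rewrite -natz natrX natz. Qed.

Lemma expz_neq0 (p e : nat) : prime p -> p%:Z ^+ e != 0.
Proof. by move=> pp; rewrite expf_neq0 //; case: p pp. Qed.

(** Supplies the natural-number representatives [sigma] and [i] over which obstructions quantify. *)
Lemma residue_nat (M : nat) (y : int) : (0 < M)%N ->
  exists2 i : nat, (i < M)%N & exists v, y = v * M%:Z + i%:Z.
Proof.
move=> M0; exists `|(y %% M)%Z|%N; last first.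
  by exists (y %/ M)%Z; rewrite gez0_abs ?modz_ge0 -?divz_eq //; lia.
by rewrite -ltz_nat gez0_abs ?modz_ge0 ?ltz_pmod //; lia.
Qed.

(** Modulo [p ^ alpha], every square root of [d] is among the residues that the obstruction lists,
    and since [beta <= alpha] its class modulo [p ^ beta] is that of the listed residue. *)
Lemma obstruction_no_root (p alpha beta : nat) (b d y : int) : prime p ->
  (beta <= alpha)%N -> obstruction p alpha beta b d ->
  (p%:Z ^+ alpha %| y ^+ 2 - d)%Z -> ~ (p%:Z ^+ beta %| y - b)%Z.
Proof.
move=> pp le_ba obs yd yb.
have pe_gt0 e : (0 < p ^ e)%N by rewrite expn_gt0 prime_gt0.
have close z v : y = z + v * p%:Z ^+ alpha -> (z = b %[mod p%:Z ^+ beta])%Z.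
  move=> yE; apply/eqmodz_dvd.
  have -> : z - b = (y - b) - v * p%:Z ^+ alpha by rewrite yE; ring.
  by rewrite rpredB // dvdz_mull // dvdz_exp2l.
case: obs => [[nd [mu [dE H]]] | [dv H]].
  have d0 : d != 0 by apply: contraNneq nd => ->; rewrite dvdz0.
  have lt_mu : (2 * mu < alpha)%N by rewrite ltnNge -dE -dvdz_pfactor.
  have dvd_d : (p%:Z ^+ (2 * mu) %| d)%Z by rewrite dvdz_pfactor ?dE.
  have /dvdzP[w yE] : (p%:Z ^+ mu %| y)%Z.
    rewrite -(dvdz_pexp2r _ _ (isT : (0 < 2)%N)) -exprM mulnC.
    rewrite -[y ^+ 2](subrK d) rpredD //.
    by apply: dvdz_trans yd; rewrite dvdz_exp2l // ltnW.
  have wd : (p%:Z ^+ (alpha - 2 * mu) %| w ^+ 2 - (d %/ p%:Z ^+ (2 * mu))%Z)%Z.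
    rewrite -(dvdz_mul2l (expz_neq0 (2 * mu) pp)) -exprD subnKC ?(ltnW lt_mu) //.
    by rewrite mulrBr mulrC [_ * (d %/ _)%Z]mulrC divzK //
      mulnC exprM -exprMn -yE.
  (* Two successive divisions of [w = y / p ^ mu]: the remainder modulo [p ^ (alpha - 2 * mu)] is
     [sigma], and the quotient modulo [p ^ mu] is [i]. What is left contributes a multiple of
     [p ^ alpha] to [y]. *)
  have [s ltsM [v wE]] := residue_nat w (pe_gt0 (alpha - 2 * mu)%N).
  have [i lti [v' vE]] := residue_nat v (pe_gt0 mu).
  rewrite !expz_nat in wE vE.
  apply: (H s ltsM _ i lti).
    apply/eqmodz_dvd; set d1 := (d %/ _)%Z in wd *.
    have -> : s%:Z ^+ 2 - d1 = (w ^+ 2 - d1) - (w - s%:Z) * (w + s%:Z) by ring.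
    by rewrite rpredB // dvdz_mulr // wE addrK dvdz_mull.
  apply: (close _ v'); rewrite yE wE vE.
  have aE : alpha = (alpha - 2 * mu + mu + mu)%N.
    by rewrite -addnA addnn -mul2n subnK // ltnW.
  have -> : (alpha - mu = (alpha - 2 * mu) + mu)%N by rewrite {1}aE addnK.
  have -> : p%:Z ^+ alpha = p%:Z ^+ (alpha - 2 * mu) * p%:Z ^+ mu * p%:Z ^+ mu.
    by rewrite -!exprD -aE.
  by rewrite exprD; ring.
have /dvdzP[w yE] : (p%:Z ^+ uphalf alpha %| y)%Z.
  by rewrite -dvdz_exp_sqr // -[y ^+ 2](subrK d) rpredD.
have [i lti [v' wE]] := residue_nat w (pe_gt0 (alpha - uphalf alpha)%N).
rewrite !expz_nat in wE.
apply: (H i lti); apply: (close _ v'); rewrite yE wE.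
have le_ua : (uphalf alpha <= alpha)%N by rewrite leq_uphalf_double; lia.
have -> : p%:Z ^+ alpha = p%:Z ^+ (alpha - uphalf alpha) * p%:Z ^+ uphalf alpha.
  by rewrite -exprD subnK.
by ring.
Qed.

(** Each residue listed in the obstruction is a square root of [d] modulo [p ^ alpha], hence
    excluded by the hypothesis. The root [y0] serves to make the multiplicity of [p] in [d] even
    when [p ^ alpha] does not divide [d]. *)
Lemma no_root_obstruction (p alpha beta : nat) (b d y0 : int) : prime p ->
  (p%:Z ^+ alpha %| y0 ^+ 2 - d)%Z ->
  (forall y, (p%:Z ^+ alpha %| y ^+ 2 - d)%Z -> ~ (p%:Z ^+ beta %| y - b)%Z) ->
  obstruction p alpha beta b d.
Proof.
move=> pp y0d H.
have [dv|nd] := boolP (p%:Z ^+ alpha %| d)%Z.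
  right; split=> // s i _ /eqmodz_dvd; apply: H.
  by rewrite rpredB // dvdz_exp_sqr // dvdz_mull.
left; split=> //; exists (multiplicity p d)./2.
have d0 : d != 0 by apply: contraNneq nd => ->; rewrite dvdz0.
have lt_ma : (multiplicity p d < alpha)%N by rewrite ltnNge -dvdz_pfactor.
have mE : multiplicity p d = (2 * (multiplicity p d)./2)%N.
  have y00 : y0 != 0.
    apply: contraNneq nd => y00; move: y0d; rewrite y00 expr0n add0r.
    by rewrite dvdzN.
  (* Up to exponent [alpha] the same powers of [p] divide [d] and [y0 ^+ 2], and [d] has
     multiplicity below [alpha]. *)
  have : multiplicity p d = multiplicity p (y0 ^+ 2).
    have y20 : y0 ^+ 2 != 0 by rewrite expf_neq0.
    have mono e : (e <= alpha)%N -> (p%:Z ^+ e %| y0 ^+ 2)%Z = (p%:Z ^+ e %| d)%Z.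
      move=> le_e; rewrite -{1}[y0 ^+ 2](subrK d) dvdzDl //.
      by apply: dvdz_trans y0d; rewrite dvdz_exp2l.
    apply/eqP; rewrite eqn_leq; apply/andP; split.
      rewrite -(dvdz_pfactor _ pp y20) mono; last exact: ltnW.
      by rewrite dvdz_pfactor.
    rewrite leqNgt -(dvdz_pfactor _ pp y20) mono //.
    by rewrite dvdz_pfactor // ltnn.
  by rewrite multiplicityX => ->; rewrite !mul2n doubleK.
set mu := (_./2)%N in mE *; split=> // d1 s _ /eqmodz_dvd sd i _ /eqmodz_dvd;
  apply: H.
have le2 : (2 * mu <= alpha)%N by rewrite -mE ltnW.
have le22 : (alpha <= (alpha - mu) + (alpha - mu))%N by move: le2; clear; lia.
have dE : d = p%:Z ^+ (2 * mu) * d1.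
  by rewrite mulrC divzK // dvdz_pfactor // mE.
(* All three terms are multiples of [p ^ alpha]; for the last one this is [2 * mu <= alpha]. *)
have -> : (s%:Z * p%:Z ^+ mu + i%:Z * p%:Z ^+ (alpha - mu)) ^+ 2 - d =
    p%:Z ^+ (2 * mu) * (s%:Z ^+ 2 - d1) + p%:Z ^+ (mu + (alpha - mu)) *
      (s%:Z *+ 2 * i%:Z) + p%:Z ^+ ((alpha - mu) + (alpha - mu)) * i%:Z ^+ 2.
  by rewrite dE mul2n -addnn !exprD; ring.
rewrite !rpredD //.
- by rewrite -{1}(subnKC le2) exprD dvdz_mul.
- by rewrite dvdz_mulr // dvdz_exp2l // -leq_subLR.
- by rewrite dvdz_mulr // dvdz_exp2l.
Qed.

(* p = 2 is covered because v_2(4a) = v_2(2a) + 1 absorbs the common factor 2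
   of y - b and y + b. *)
Lemma root_up_to_sign (p : nat) (a b y : int) : prime p -> a != 0 ->
  (p%:Z %| 2 * a)%Z ->
  (p%:Z ^+ multiplicity p (4 * a) %| (y - b) * (y + b))%Z ->
  multiplicity p (2 * a) = 1%N \/ ~~ (p%:Z %| b)%Z ->
  (p%:Z ^+ multiplicity p (2 * a) %| y - b)%Z \/
  (p%:Z ^+ multiplicity p (2 * a) %| y + b)%Z.
Proof.
move=> pp a0 pa.
have -> : 4 * a = 2 * (2 * a) by ring.
have a20 : 2 * a != 0 by rewrite mulf_neq0.
rewrite multiplicityM //.
have b_gt0 : (0 < multiplicity p (2 * a))%N by rewrite -dvdz_pfactor ?expr1.
set be := multiplicity p (2 * a) in b_gt0 *.
have [->|p2] := eqVneq p 2%N.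
  have -> : multiplicity 2 2 = 1%N by [].
  rewrite add1n exprS => H [be1|b2].
    rewrite be1 expr1 in H *; left.
    have : (2 %| (y - b) * (y + b))%Z by apply: dvdz_trans H; rewrite dvdz_mulr.
    rewrite (dvdz_prime_mul _ _ (isT : prime 2)) => /orP[//|].
    have -> : y + b = (y - b) + 2 * b by ring.
    by rewrite (dvdzDr (y - b)) //; exact: dvdz_mulr.
  have yb : (2 %| y - b)%Z.
    have : (2 %| (y - b) * (y + b))%Z by apply: dvdz_trans H; rewrite dvdz_mulr.
    rewrite (dvdz_prime_mul _ _ (isT : prime 2)) => /orP[//|].
    have -> : y + b = (y - b) + 2 * b by ring.
    by rewrite (dvdzDr (y - b)) //; exact: dvdz_mulr.
  (* Here [y - b = 2 * t] and [y + b = 2 * (t + b)] with [b] odd, so exactly one of [t] and [t + b]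
     is odd and the other carries the whole power of 2. *)
  have /dvdzP[t tE] := yb.
  have [t2|t2] := boolP (2 %| t)%Z.
    left; rewrite -(Gauss_dvdzl _ (p := t + b)); last first.
      by apply: (coprime_prime_exp _ (isT : prime 2)); rewrite dvdzDl.
    rewrite -(dvdz_mul2l (isT : (2 : int) != 0)); apply: dvdz_trans H _.
    have -> : y + b = 2 * (t + b) by rewrite -[y](subrK b) tE; ring.
    by rewrite mulrCA dvdzz.
  right; rewrite -(Gauss_dvdzr _ (m := 2%:Z ^+ be) (n := t)); last first.
    exact: (coprime_prime_exp _ (isT : prime 2)).
  rewrite -(dvdz_mul2l (isT : (2 : int) != 0)); apply: dvdz_trans H _.
  by rewrite mulrA [2 * t]mulrC -tE.
have -> : multiplicity p 2 = 0%N.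
  by rewrite /multiplicity lognE /= dvdn_prime2 // (negbTE p2) andbF.
rewrite add0n => H [be1|pb].
  by move: H; rewrite be1 expr1 dvdz_prime_mul // => /orP.
have [pyb|pyb] := boolP (p%:Z %| y - b)%Z.
  left; rewrite -(Gauss_dvdzl _ (p := y + b)) //;
    apply: coprime_prime_exp => //.
  have -> : y + b = (y - b) + 2 * b by ring.
  rewrite dvdzDl //; by rewrite dvdz_prime_mul //
    (negbTE pb) orbF dvdzE dvdn_prime2.
right; rewrite -(Gauss_dvdzr _ (n := y - b)) //; exact: coprime_prime_exp.
Qed.

(** * Rigidity and lifting at a prime *)

Lemma dvdz_prime_prod (s : seq nat) (f : nat -> nat) (D : int) :
  (forall q, q \in s -> prime q) -> uniq s ->
  (forall q, q \in s -> (q%:Z ^+ f q %| D)%Z) ->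
  (\prod_(q <- s) q%:Z ^+ f q %| D)%Z.
Proof.
elim: s => [|p s IH] ps; first by rewrite big_nil dvd1z.
case/andP=> pNs us H; rewrite big_cons Gauss_dvdz ?H ?mem_head //=.
  by apply: IH => // q qs; [apply: ps | apply: H]; rewrite inE qs orbT.
apply: coprime_prime_prod => //; first by apply: ps; exact: mem_head.
by move=> q qs; apply: ps; rewrite inE qs orbT.
Qed.

(** One factor [p] of [r] already upgrades divisibility of [z ^+ 2 - D] from exponent [e - 1] to
    [e]. Testing this at 0, at powers of [p] and at a perturbation of [z0] leaves only the stated
    possibility. *)
Lemma odd_prime_rigid (p e : nat) (r D z0 : int) : prime p -> odd p ->
  (0 < e)%N -> (p%:Z %| r)%Z ->
  (forall z, (p%:Z ^+ e %| r * (z ^+ 2 - D))%Z -> (p%:Z ^+ e %| z ^+ 2 - D)%Z) ->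
  (p%:Z ^+ e %| z0 ^+ 2 - D)%Z ->
  [/\ ~~ odd e, (p%:Z ^+ e %| D)%Z & ~~ (p%:Z ^+ 2 %| r)%Z].
Proof.
(* From here on [e] is one less than the exponent of the statement. *)
case: e => // e pp op _ pr H z0D.
have p_gt1 : 1 < `|p%:Z| by move: (prime_gt1 pp); lia.
have step z : (p%:Z ^+ e %| z ^+ 2 - D)%Z -> (p%:Z ^+ e.+1 %| z ^+ 2 - D)%Z.
  by move=> zD; apply: H; rewrite (exprS p%:Z e) dvdz_mul.
have weak z : (p%:Z ^+ e.+1 %| z)%Z -> (p%:Z ^+ e %| z)%Z.
  by apply: dvdz_trans; rewrite dvdz_exp2l.
have [hz|hz] := boolP (p%:Z ^+ uphalf e %| z0)%Z.
  have eD : (p%:Z ^+ e.+1 %| D)%Z.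
    have := step 0; rewrite expr0n /= sub0r !dvdzN; apply.
    rewrite -[D](subKr (z0 ^+ 2)) rpredB ?(weak (_ - _)) //.
    by rewrite dvdz_exp_sqr.
  (* Test value [z = p ^ uphalf e]: its square is divisible by [p ^ e], hence by [p ^ e.+1], which
     forces [e] to be odd. *)
  have le_e : (e.+1 <= uphalf e * 2)%N.
    rewrite -(dvdz_Pexp2l _ _ p_gt1) exprM -[X in (_ %| X)%Z](subrK D) rpredD //.
    by apply: step; rewrite rpredB ?(weak D) // dvdz_exp_sqr.
  have oe : odd e by move: le_e; rewrite muln2 uphalfK; case: (odd e);
    rewrite ?ltnn.
  split=> //=; first by rewrite negbK.
  apply/negP => ppr.
  have e2 : (uphalf e).*2 = e.+1 by rewrite odd_uphalfK.
  have h0 : (0 < uphalf e)%N by rewrite uphalf_gt0; case: (e) oe.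
  (* If [p ^ 2] divided [r], the smaller test value [p ^ (uphalf e).-1], with square [p ^ (e - 1)],
     would also satisfy the premise of [H]. *)
  have : (e.+1 <= (uphalf e).-1 * 2)%N.
    rewrite -(dvdz_Pexp2l _ _ p_gt1) exprM -[X in (_ %| X)%Z](subrK D) rpredD //.
    apply: H; have -> : e.+1 = (2 + (uphalf e).-1 * 2)%N.
      by move: e2 h0; clear; lia.
    rewrite exprD dvdz_mul // rpredB //; first by rewrite -exprM.
    by apply: dvdz_trans eD; rewrite dvdz_exp2l //; move: e2 h0; clear; lia.
  by move: e2 h0; clear; lia.
have z00 : z0 != 0 by apply: contraNneq hz => ->; rewrite dvdz0.
have [w z0E pw] := multiplicityP pp z00.
move: hz; rewrite dvdz_pfactor // -ltnNge; set t := multiplicity p z0 in z0E *.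
rewrite gtn_uphalf_double => lt_te.
have e1 : (e - t = t + (e - t.*2))%N by move: lt_te; clear; lia.
have e2 : (e = (e - t) + t)%N by move: lt_te; clear; lia.
(* With [t] the multiplicity of [p] in [z0], this shift changes the square by [p ^ e] times a number
   prime to [p], so [step] fails at the shifted point. *)
have zE : (z0 + p%:Z ^+ (e - t)) ^+ 2 - D =
    (z0 ^+ 2 - D) + p%:Z ^+ e * (2 * w + p%:Z ^+ (e - t.*2)).
  by rewrite [in p%:Z ^+ e]e2 e1 z0E !exprD; ring.
have := step (z0 + p%:Z ^+ (e - t)).
rewrite zE => /(_ _) /wrap[]; first by rewrite rpredD ?(weak (_ - _)) //
  dvdz_mulr.
rewrite dvdzDl // exprSr => pd.
have : (p%:Z %| 2 * w + p%:Z ^+ (e - t.*2))%Z.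
  by move: pd; rewrite (dvdz_mul2l (expz_neq0 e pp)).
rewrite dvdzDr; last by rewrite dvdz_exp // subn_gt0.
rewrite (dvdz_prime_mul _ _ pp) (negbTE pw) orbF.
by rewrite dvdzE /= dvdn_prime2 // => /eqP p2; rewrite p2 in op.
Qed.

Lemma odd_sqr_mod8 (w : int) : ~~ (2 %| w)%Z -> (8 %| w ^+ 2 - 1)%Z.
Proof.
move=> w2; have [q wE] : exists q, w = 2 * q + 1.
  exists (w %/ 2)%Z; move: w2; lia.
have [t tE] : exists t, q * (q + 1) = 2 * t.
  have [qE|qE] : q = 2 * (q %/ 2)%Z \/ q = 2 * (q %/ 2)%Z + 1 by lia.
    by exists ((q %/ 2)%Z * (q + 1)); rewrite {1}qE; ring.
  exists (q * ((q %/ 2)%Z + 1)).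
  by rewrite [in q + 1]qE; ring.
apply/dvdzP; exists t; rewrite wE.
have -> : (2 * q + 1) ^+ 2 - 1 = 4 * (q * (q + 1)) by ring.
by rewrite tE; ring.
Qed.

(** Used with [K = k - 3] and [E = D / 4], where 2 has multiplicity [K.+1] in [M] and [K.+3] in
    [n / r]. Were [z0] highly divisible by 2, the values 0 and [2 ^ uphalf K.+1] would both lift,
    which is impossible. Otherwise a perturbation of [z0] forces its multiplicity to be [K / 2], and
    [E] is [2 ^ K] times an odd square modulo 8. *)
Lemma two_rigid (K : nat) (r E z0 : int) :
  (forall z, (2 ^+ K.+1 %| r * (z ^+ 2 - E))%Z -> (2 ^+ K.+3 %| z ^+ 2 - E)%Z) ->
  (2 ^+ K.+3 %| z0 ^+ 2 - E)%Z ->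
  [/\ ~~ odd K, ~~ (2 %| r)%Z &
    exists2 u, E = 2 ^+ K * u & (8 %| u - 1)%Z].
Proof.
move=> H z0E.
have p2 : prime 2 by [].
have sqr2 e (z : int) : (2 ^+ e %| z ^+ 2)%Z = (2 ^+ uphalf e %| z)%Z.
  exact: dvdz_exp_sqr e z p2.
have gt1 : 1 < `|2 : int| by [].
have weak z : (2 ^+ K.+3 %| z)%Z -> (2 ^+ K.+1 %| z)%Z.
  by apply: dvdz_trans; rewrite dvdz_exp2l // !ltnS leqW.
have [hz|hz] := boolP (2 ^+ uphalf K.+1 %| z0)%Z.
  have ED : (2 ^+ K.+3 %| E)%Z.
    have := H 0; rewrite expr0n /= sub0r !dvdzN; apply.
    rewrite dvdz_mull // dvdzN -[E](subKr (z0 ^+ 2)).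
    by rewrite rpredB ?(weak (_ - _)) //; rewrite ?[_ \in _]sqr2.
  have : (K.+3 <= uphalf K.+1 * 2)%N.
    rewrite -(dvdz_Pexp2l _ _ gt1) exprM -[X in (_ %| X)%Z](subrK E) rpredD //.
    apply: H; rewrite dvdz_mull // rpredB ?(weak E) //.
    by rewrite sqr2.
  by rewrite muln2 uphalfK; case: (odd _); rewrite ?add0n ?add1n ?ltnn //
    ltnS ltnNge leqnSn.
have z00 : z0 != 0 by apply: contraNneq hz => ->; rewrite dvdz0.
have [w z0w pw] := multiplicityP p2 z00.
move: hz; rewrite [(_ %| _)%Z](dvdz_pfactor _ p2 z00) -ltnNge.
set t := multiplicity 2 z0 in z0w *.
rewrite gtn_uphalf_double ltnS => le_tK.
case/dvdzP: z0E => q qE.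
have EE : E = z0 ^+ 2 - q * 2 ^+ K.+3 by rewrite -qE; ring.
have Kt : K = t.*2.
  apply/eqP; rewrite eqn_leq le_tK andbT leqNgt; apply/negP => lt_tK.
  have [j jE] : exists j, (K = t + t + j.+1)%N.
    by exists (K - t.*2).-1; move: lt_tK; clear; lia.
  (* The shift is [2 ^ (K + 1 - t)]: it changes the square by exactly [2 ^ K.+2] times an odd
     number, so the premise of [H] survives and its conclusion does not. *)
  have zE : (z0 + 2 ^+ (t + j.+2)) ^+ 2 - E =
      q * 2 ^+ K.+3 + 2 ^+ K.+2 * (w + 2 ^+ j.+1).
    rewrite EE z0w jE -[(_ + _).+3]addn3 -[(_ + _).+2]addn2 !exprD !exprS; ring.
  have /(_ _)/wrap[] := H (z0 + 2 ^+ (t + j.+2)).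
    rewrite zE dvdz_mull // rpredD //; first by rewrite dvdz_mull // weak.
    by rewrite dvdz_mulr // dvdz_exp2l.
  rewrite zE dvdzDl; last by rewrite dvdz_mull.
  rewrite (exprSr 2 K.+2) => pd.
  have : (2 %| w + 2 ^+ j.+1)%Z.
    by move: pd; rewrite [(_ %| _)%Z](dvdz_mul2l (expz_neq0 K.+2 p2)).
  by rewrite dvdzDr ?dvdz_exp // (negbTE pw).
have uE : E = 2 ^+ K * (w ^+ 2 - 8 * q).
  by rewrite EE z0w Kt -addnn -[(_ + _).+3]addn3 !exprD; ring.
have u8 : (8 %| w ^+ 2 - 8 * q - 1)%Z.
  by rewrite addrAC rpredB ?odd_sqr_mod8 // dvdz_mulr.
split; [by rewrite Kt odd_double | | by exists (w ^+ 2 - 8 * q)].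
apply/negP => r2; have := H 0; rewrite expr0n add0r => /(_ _)/wrap[].
  by rewrite (exprS 2 K) dvdz_mul // dvdzN uE dvdz_mulr.
have -> : 2 ^+ K.+3 = 2 ^+ K * 8 :> int by rewrite !exprS; ring.
rewrite dvdzN uE (dvdz_mul2l (expz_neq0 K p2)) => u0; move: u8.
by rewrite [(_ %| _)%Z](dvdzDl _ u0).
Qed.

(** The condition on [delta], prime by prime. The last clause expresses that the primes are
    distinct: an even positive multiplicity in [m] is at least 2, so [p ^ 2] divides [gcdz m r] as
    soon as it divides [r]. *)
Definition locally_liftable (m r D : int) : Prop :=
  forall p : nat, prime p -> (p%:Z %| m)%Z -> (p%:Z %| r)%Z ->
  [/\ ~~ odd (multiplicity p m), (p%:Z ^+ multiplicity p m %| D)%Z &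
      ~~ (p%:Z ^+ 2 %| r)%Z].

Lemma prime_dvd_prod (p : nat) (s : seq nat) : prime p ->
  (forall q, q \in s -> prime q) ->
  (p%:Z %| \prod_(q <- s) q%:Z)%Z = (p \in s).
Proof.
move=> pp; elim: s => [|q s IH] ps.
  by rewrite big_nil dvdzE dvdn1; case: p pp => [|[]].
rewrite big_cons dvdz_prime_mul // IH; last by move=> x xs; apply: ps;
  rewrite inE xs orbT.
by rewrite inE dvdzE dvdn_prime2 // ps // mem_head.
Qed.

Lemma delta_condition_local (m r D : int) : m != 0 -> ~~ (2 %| m)%Z ->
  delta_condition (gcdz m r) m D <-> locally_liftable m r D.
Proof.
move=> m0 m2; split=> [H p pp pm pr | H].
  have pd : (p%:Z %| gcdz m r)%Z by rewrite dvdz_gcd pm pr.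
  case: H => [d1 | [ps [ups pps dE evs Dv]]].
    by move: pd; rewrite d1 dvdzE dvdn1; case: p pp {pm pr} => [|[]].
  have pP q : q \in ps -> prime q by move/pps => [].
  have pps' : p \in ps by rewrite -(prime_dvd_prod pp pP) -dE.
  have ev := evs p pps'; split=> //.
    by apply: dvdz_trans Dv; rewrite (big_rem p) //= dvdz_mulr.
  apply/negP => ppr.
  have m_gt1 : (1 < multiplicity p m)%N.
    have : (0 < multiplicity p m)%N by rewrite -dvdz_pfactor ?expr1.
    by case: (multiplicity p m) ev => [|[]].
  have : (p%:Z ^+ 2 %| gcdz m r)%Z by rewrite dvdz_gcd ppr dvdz_pfactor //
    m_gt1.
  rewrite dE (big_rem p) //= exprS expr1.
  rewrite dvdz_mul2l; last by case: (p) pp.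
  rewrite prime_dvd_prod //; last by move=> q /mem_rem; exact: pP.
  by rewrite mem_rem_uniq // inE eqxx.
have [d1|d1] := eqVneq (gcdz m r) 1; [by left | right].
have g0 : gcdz m r != 0 by rewrite gcdz_eq0 negb_and m0.
have P p : p \in primes `|gcdz m r| -> [/\ prime p, (p%:Z %| m)%Z & (p%:Z %| r)%Z].
  rewrite mem_primes => /and3P[pp _ pd].
  have : (p%:Z %| gcdz m r)%Z by rewrite dvdzE.
  by rewrite dvdz_gcd => /andP[].
exists (primes `|gcdz m r|); split.
- exact: primes_uniq.
- move=> p /P[pp pm _]; split=> //.
  by apply: contraNT m2 => /(prime_oddPn pp) p2; move: pm; rewrite p2.
- have g_gt0 : (0 < `|gcdz m r|)%N by rewrite absz_gt0.
  rewrite -[LHS]gez0_abs //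
    [in LHS](prod_prime_decomp g_gt0) prime_decompE big_map /=.
  rewrite (big_morph Posz PoszM (erefl _)); apply: eq_big_seq => p pg.
  have [pp pm pr] := P _ pg; have [_ _ ppr] := H p pp pm pr.
  suff -> : logn p `|gcdz m r| = 1%N by rewrite expn1.
  apply/eqP; rewrite eqn_leq logn_gt0 pg andbT leqNgt.
  apply: contra ppr => lt1;
    have : (p%:Z ^+ 2 %| gcdz m r)%Z by rewrite dvdz_pfactor.
  by rewrite dvdz_gcd => /andP[].
- by move=> p /P[pp pm pr]; have [] := H p pp pm pr.
- apply: dvdz_prime_prod; first by move=> p /P[].
    exact: primes_uniq.
  by move=> p /P[pp pm pr]; have [] := H p pp pm pr.
Qed.

(** Only primes dividing both [m] and [r] matter. There [r] absorbs exactly one factor [p], and for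
    an even exponent [e] with [p ^ e] dividing [D], divisibility of [z ^+ 2] by [p ^ (e - 1)] and by
    [p ^ e] both mean that [p ^ (e / 2)] divides [z]. *)
Lemma sqr_sub_lift (m r D z : int) : m != 0 -> locally_liftable m r D ->
  (m %| r * (z ^+ 2 - D))%Z -> (m %| z ^+ 2 - D)%Z.
Proof.
move=> m0 H mr; apply: dvdz_local => // p pp.
have pmr : (p%:Z ^+ multiplicity p m %| r * (z ^+ 2 - D))%Z.
  by apply: dvdz_trans mr; rewrite dvdz_pfactor.
have [pr|pr] := boolP (p%:Z %| r)%Z; last first.
  by rewrite -(Gauss_dvdzr _ (n := r)) //; exact: coprime_prime_exp.
have [pm|pm] := boolP (p%:Z %| m)%Z; last first.
  by move: pm; rewrite -[p%:Z]expr1 dvdz_pfactor // -eqn0Ngt => /eqP->;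
    rewrite dvd1z.
have [ev pD ppr] := H p pp pm pr; move: ev pD pmr.
have : (0 < multiplicity p m)%N by rewrite -dvdz_pfactor ?expr1.
case: (multiplicity p m) => // e _ oe pD.
case/dvdzP: pr ppr => r' -> ppr.
rewrite mulrAC [_ * p%:Z]mulrC (exprS p%:Z e) dvdz_mul2l; last by case: (p) pp.
rewrite Gauss_dvdzr; last first.
  apply: coprime_prime_exp => //; apply: contra ppr => pr'.
  by rewrite expr2 dvdz_mul.
have pDe : (p%:Z ^+ e %| D)%Z by apply: dvdz_trans pD; rewrite dvdz_exp2l.
rewrite -(exprS p%:Z e) !dvdzDr ?dvdzN //.
rewrite !dvdz_exp_sqr //.
suff -> : uphalf e = uphalf e.+1 by [].
by rewrite /= uphalf_half; move: oe => /= /negPn ->.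
Qed.

Lemma quad_lift (m r A B C x : int) : m != 0 -> coprimez m (4 * A) ->
  locally_liftable m r (B ^+ 2 - 4 * A * C) ->
  (m %| r * quad A B C x)%Z -> (m %| quad A B C x)%Z.
Proof.
move=> m0 co H mr.
rewrite -(Gauss_dvdzr _ co) quad_complete_square; apply: (sqr_sub_lift m0 H).
by rewrite -quad_complete_square mulrCA dvdz_mull.
Qed.

Lemma quad_root (q A B C : int) : coprimez q (2 * A) ->
  quadratic_residue (B ^+ 2 - 4 * A * C) q ->
  exists x, (q %| quad A B C x)%Z.
Proof.
move=> co [y /eqmodz_dvd yq]; have [x xq] := linear_solve (y - B) co.
exists x; rewrite -(Gauss_dvdzr _ co) -(Gauss_dvdzr _ (n := 2)); last first.
  by move: co; rewrite coprimezMr => /andP[].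
have -> : 2 * (2 * A * quad A B C x) =
    (y ^+ 2 - (B ^+ 2 - 4 * A * C)) +
    (2 * A * x - (y - B)) * (2 * A * x + B + y) by rewrite /quad; ring.
by rewrite rpredD // dvdz_mulr.
Qed.

(* u is a 2-adic square because it is 1 mod 8. *)
Lemma two_lift (K : nat) (u z : int) : ~~ odd K -> (8 %| u - 1)%Z ->
  (2 ^+ K.+1 %| z ^+ 2 - 2 ^+ K * u)%Z -> (2 ^+ K.+3 %| z ^+ 2 - 2 ^+ K * u)%Z.
Proof.
move=> eK u8 zu.
have K0 : 2 ^+ K != 0 :> int by rewrite expf_neq0.
have /dvdzP[w zE] : (2 ^+ K./2 %| z)%Z.
  rewrite -(dvdz_pexp2r _ _ (isT : (0 < 2)%N)) -exprM muln2 even_halfK //.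
  rewrite -[z ^+ 2](subrK (2 ^+ K * u)) rpredD ?dvdz_mulr //.
  by apply: dvdz_trans zu; rewrite dvdz_exp2l.
have zE2 : z ^+ 2 - 2 ^+ K * u = 2 ^+ K * (w ^+ 2 - u).
  by rewrite zE exprMn -exprM muln2 even_halfK //; ring.
move: zu; rewrite zE2 (exprSr _ K) [(_ %| _)%Z](dvdz_mul2l K0) => wu.
have -> : 2 ^+ K.+3 = 2 ^+ K * 8 :> int by rewrite !exprS; ring.
rewrite [(_ %| _)%Z](dvdz_mul2l K0).
have w2 : ~~ (2 %| w)%Z.
  apply/negP => w2; have : (2 %| u - 1)%Z by apply: dvdz_trans u8.
  have : (2 %| u)%Z by rewrite -[u](subKr (w ^+ 2)) rpredB // dvdz_exp.
  by move=> u2; rewrite [(_ %| _)%Z](dvdzDl _ u2).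
have -> : w ^+ 2 - u = (w ^+ 2 - 1) - (u - 1) by ring.
by rewrite rpredB // odd_sqr_mod8.
Qed.

(** Reduces the global implication to one prime: a point [x1] that is good at [p] is glued to the
    global solution [x0] away from [p]. *)
Lemma localize (F : int -> int) (M N r x0 : int) : congr_fun F ->
  M != 0 -> N != 0 -> (M %| N)%Z -> (M %| r * F x0)%Z ->
  (forall x, (M %| r * F x)%Z -> (N %| F x)%Z) ->
  forall (p : nat) x1, prime p -> (p%:Z ^+ multiplicity p M %| r * F x1)%Z ->
  (p%:Z ^+ multiplicity p N %| F x1)%Z.
Proof.
move=> cF M0 N0 MN Mx0 H p x1 pp Mx1.
have [M' ME pM'] := multiplicityP pp M0.
have co e : coprimez (p%:Z ^+ e) M' by exact: coprime_prime_exp.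
(* Agreement with [x1] is imposed to the full exponent of [p] in [N], so that the conclusion can be
   carried back to [x1]. *)
have [x [xx1 xx0]] := chinese_dvd x1 x0 (co (multiplicity p N)).
rewrite -(congr_fun_dvd cF xx1).
apply: (@dvdz_trans N); first by rewrite dvdz_pfactor.
apply: H; rewrite ME Gauss_dvdz //; apply/andP; split.
  rewrite -[r * _](subrK (r * F x1)) rpredD // -mulrBr dvdz_mull // cF //.
  apply: dvdz_trans xx1; apply: dvdz_exp2l.
  by rewrite -dvdz_pfactor //; apply: dvdz_trans MN; rewrite dvdz_pfactor.
rewrite -[r * _](subrK (r * F x0)) rpredD //.
  by rewrite -mulrBr dvdz_mull // cF.
by apply: dvdz_trans Mx0; rewrite ME dvdz_mull.
Qed.

(** * Reduction modulo M *)

Lemma coprime_not_dvd (p : nat) (q z : int) : prime p ->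
  (p%:Z %| q)%Z -> coprimez q z -> ~~ (p%:Z %| z)%Z.
Proof.
move=> pp pq /coprimezP[[u v] /= uv]; apply/negP => pz.
have : (p%:Z %| 1%R)%Z by rewrite -uv rpredD // dvdz_mull.
by rewrite dvdzE dvdn1; case: p pp {pq pz} => [|[]].
Qed.

(** The second congruence determines [s] as [2 * a * x + b] modulo [n]; the first then says that [n]
    divides [4 * a * quad a b c x]. One direction of the equivalence in IQF is thus automatic. *)
Lemma IQF_validE (a b c n : int) :
  IQF_valid a b c n <->
  forall x, (n %| 4 * a * quad a b c x)%Z -> (n %| quad a b c x)%Z.
Proof.
have E x : (exists s : int, (s ^+ 2 = b ^+ 2 - 4 * a * c %[mod n])%Z /\
    (2 * a * x = - b + s %[mod n])%Z) <-> (n %| 4 * a * quad a b c x)%Z.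
  rewrite quad_complete_square; split=> [[s [/eqmodz_dvd sd /eqmodz_dvd sx]]|H].
    set y := _ + b; have -> : y ^+ 2 - (b ^+ 2 - 4 * a * c) =
      (s ^+ 2 - (b ^+ 2 - 4 * a * c)) + (2 * a * x - (- b + s)) * (y + s).
      by rewrite /y; ring.
    by rewrite rpredD // dvdz_mulr.
  exists (2 * a * x + b); split; apply/eqmodz_dvd => //.
  by have -> : 2 * a * x - (- b + (2 * a * x + b)) = 0 by ring.
split=> H x.
  by move/E/H/eqmodz_dvd; rewrite subr0.
split=> [/eqmodz_dvd|/E/H fx]; first by rewrite subr0 => fx; apply/E;
  rewrite dvdz_mull.
by apply/eqmodz_dvd; rewrite subr0.
Qed.

(** This is [2 ^+ k * m] divided by its greatest common divisor with 4, up to sign the modulus left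
    after cancelling [4 * a] against [n]. *)
Definition reduced_modulus (k : nat) (m : int) : int :=
  if (k <= 2)%N then m else 2 ^+ (k - 2) * m.

(** Coprimality of [a'] with [2 ^+ k * m] is the form in which [r = gcdz a n] enters the
    argument. *)
Definition reduction (a n r a' m : int) (k : nat) : Prop :=
  [/\ a = r * a', n = 2 ^+ k * m * r, r != 0 /\ a' != 0, m != 0 /\ ~~ (2 %| m)%Z &
      coprimez (2 ^+ k * m) a'].

Section Reduction.

Variables (a b c n r a' m : int) (k : nat).
Hypothesis red : reduction a n r a' m k.

Let M := reduced_modulus k m.

Lemma red_m_neq0 : m != 0. Proof. by case: red => _ _ _ []. Qed.

Lemma red_m_odd : ~~ (2 %| m)%Z. Proof. by case: red => _ _ _ []. Qed.

Lemma red_a_neq0 : a != 0.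
Proof. by case: red => -> _ [r0 a0] _ _; rewrite mulf_neq0. Qed.

Lemma red_N_neq0 : 2 ^+ k * m != 0.
Proof. by rewrite mulf_neq0 ?expf_neq0 // red_m_neq0. Qed.

Lemma red_M_neq0 : M != 0.
Proof.
by rewrite /M /reduced_modulus; case: ifP => _;
  rewrite ?mulf_neq0 ?expf_neq0 ?red_m_neq0.
Qed.

Lemma coprime_m_4 : coprimez m 4.
Proof.
have -> : 4 = 2%:Z ^+ 2 by [].
by rewrite coprimez_sym; exact: (coprime_prime_exp 2 (isT : prime 2) red_m_odd).
Qed.

Lemma coprime_m_4a' : coprimez m (4 * a').
Proof.
rewrite coprimezMr coprime_m_4; case: red => _ _ _ _.
by rewrite coprimezMl => /andP[].
Qed.

Lemma red_a'_odd : (0 < k)%N -> ~~ (2 %| a')%Z.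
Proof.
move=> k0; case: red => _ _ _ _; rewrite coprimezMl => /andP[co _].
apply/negP => a2; move: co; rewrite coprimez_pexpl // coprimezE.
by rewrite [coprime _ _](prime_coprime _ (isT : prime 2)) => /negP; apply.
Qed.

Lemma modulus_four : (2 < k)%N -> 2 ^+ k * m = 4 * M.
Proof.
move=> k2; rewrite /M /reduced_modulus leqNgt k2 /= mulrA; congr (_ * _).
by rewrite -{1}(subnKC (ltnW k2)) exprD.
Qed.

Lemma modulus_dvd : (M %| 2 ^+ k * m)%Z.
Proof.
have [k2|k2] := leqP k 2; first by rewrite /M /reduced_modulus k2 dvdz_mull.
by rewrite modulus_four // dvdz_mull.
Qed.

Lemma red_dvd4 z : (n %| 4 * a * z)%Z = (M %| z)%Z.
Proof.
case: (red) => -> -> [r0 _] _ co.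
have -> : 4 * (r * a') * z = a' * (4 * z) * r by ring.
rewrite dvdz_mul2r // Gauss_dvdzr //.
have [k2|k2] := leqP k 2; last first.
  by rewrite modulus_four // dvdz_mul2l.
rewrite /M /reduced_modulus k2 Gauss_dvdz; last first.
  by apply: coprimezXl; rewrite coprimez_sym; move: coprime_m_4;
    rewrite (_ : 4 = 2 ^+ 2) // coprimez_pexpr.
rewrite dvdz_mulr /=; last by rewrite (_ : 4 = 2 ^+ 2) // dvdz_exp2l.
by rewrite Gauss_dvdzr // coprime_m_4.
Qed.

Lemma IQF_valid_modulus :
  IQF_valid a b c n <->
  forall x, (M %| quad a b c x)%Z -> (n %| quad a b c x)%Z.
Proof.
rewrite IQF_validE.
by split=> H x; have := H x; rewrite red_dvd4.
Qed.

Lemma condition_modulus :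
  (if (k <= 2)%N then 4 * a * m else 2 ^+ k * a * m) = 4 * a * M.
Proof.
case: ifP => [k2|/negbT]; first by rewrite /M /reduced_modulus k2.
by rewrite -ltnNge => k2; rewrite mulrAC modulus_four // mulrAC.
Qed.

(** A root [x] modulo [M] would yield [y = 2 * a * x + b], a square root of [d] modulo [p ^ alpha]
    congruent to [b] modulo [p ^ beta]. *)
Lemma condition_i_no_root x :
  condition_i a b (b ^+ 2 - 4 * a * c) m k -> ~ (M %| quad a b c x)%Z.
Proof.
case=> p [pp pa] /=; rewrite condition_modulus => -[/andP[_ lt_ba] _ _ obs] Mx.
have a0 := red_a_neq0; have M0 := red_M_neq0.
apply: (obstruction_no_root pp (ltnW lt_ba) obs (y := 2 * a * x + b)).
  rewrite -quad_complete_square.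
  apply: (@dvdz_trans (4 * a * M)); first by rewrite dvdz_pfactor // !mulf_neq0.
  by rewrite dvdz_mul.
by rewrite addrK dvdz_mulr // dvdz_pfactor // mulf_neq0.
Qed.

Lemma red_not_dvd_a' p : prime p -> (p%:Z %| M)%Z -> ~~ (p%:Z %| a')%Z.
Proof.
move=> pp pM; case: red => _ _ _ _ co; apply: (coprime_not_dvd pp _ co).
exact: dvdz_trans modulus_dvd.
Qed.

(** Makes a square root of [d] modulo [n] one modulo [p ^ alpha]. For [k >= 3],
    [4 * a * M = n * a']; for [k <= 2], [4 * a' * n = 2 ^+ k * (4 * a * M)] and [p] divides [m]. The
    cofactor of [n] is prime to [p] in both cases. *)
Lemma red_pfactor_dvd_n p : prime p -> (p%:Z %| M)%Z ->
  (p%:Z ^+ multiplicity p (4 * a * M) %| n)%Z.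
Proof.
move=> pp pM; have pa' := red_not_dvd_a' pp pM.
have : (p%:Z ^+ multiplicity p (4 * a * M) %| 4 * a * M)%Z.
  by rewrite dvdz_pfactor // !mulf_neq0 ?red_a_neq0 ?red_M_neq0.
move: (multiplicity p _) => e; have [k2|k2] := leqP k 2.
  have ME : M = m by rewrite /M /reduced_modulus k2.
  move=> peM; rewrite -(Gauss_dvdzr _ (n := 4 * a')); last first.
    apply: coprime_prime_exp => //; apply: (coprime_not_dvd pp _ coprime_m_4a').
    by rewrite -ME.
  case: red => aE -> _ _ _.
  have -> : 4 * a' * (2 ^+ k * m * r) = 2 ^+ k * (4 * a * M).
    by rewrite ME aE; ring.
  by rewrite dvdz_mull.
rewrite mulrAC -modulus_four //; case: red => -> -> _ _ _.
by rewrite mulrA Gauss_dvdzl //; exact: coprime_prime_exp.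
Qed.

(** If (i) fails, there is a root at every prime, and these glue. The delicate primes divide both
    [M] and [2 * a]; there the absence of a local root produces the obstruction. *)
Lemma no_root_condition_i : quadratic_residue (b ^+ 2 - 4 * a * c) n ->
  (forall x, ~ (M %| quad a b c x)%Z) ->
  condition_i a b (b ^+ 2 - 4 * a * c) m k.
Proof.
move=> [y0 /eqmodz_dvd y0n] noroot; apply: NNPP => not_i.
have a0 := red_a_neq0; have M0 := red_M_neq0.
have [x Mx] : exists x, (M %| quad a b c x)%Z; last exact: noroot Mx.
apply: chinese_solvable => [||p pp]; [exact: congr_quad | exact: M0 |].
have [pM|pM] := boolP (p%:Z %| M)%Z; last first.
  exists 0; move: pM; rewrite -[p%:Z]expr1 dvdz_pfactor // -eqn0Ngt.
  by move/eqP->; rewrite dvd1z.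
set e := multiplicity p M.
have e_gt0 : (0 < e)%N by rewrite -dvdz_pfactor ?expr1.
have a20 : 2 * a != 0 by rewrite mulf_neq0.
have [pa|pa] := boolP (p%:Z %| 2 * a)%Z; last first.
  apply: quad_root; first exact: coprime_prime_exp.
  exists y0; apply/eqmodz_dvd; apply: dvdz_trans y0n.
  have -> : n = (n %/ M)%Z * M.
    rewrite divzK //; case: red => _ -> _ _ _; rewrite dvdz_mulr //.
    exact: modulus_dvd.
  by rewrite dvdz_mull // dvdz_pfactor.
apply: NNPP => no_local; apply: not_i; exists p; split=> //=.
rewrite condition_modulus.
set al := multiplicity p (4 * a * M); set be := multiplicity p (2 * a).
have a40 : 4 * a != 0 by rewrite mulf_neq0.
have alE : al = (multiplicity p (4 * a) + e)%N by rewrite /al multiplicityM.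
have le_be : (be <= multiplicity p (4 * a))%N.
  by rewrite -dvdz_pfactor // -[4]/(2 * 2 : int) -mulrA dvdz_mull //
    dvdz_pfactor.
have y0d : (p%:Z ^+ al %| y0 ^+ 2 - (b ^+ 2 - 4 * a * c))%Z.
  by apply: dvdz_trans y0n; exact: red_pfactor_dvd_n.
(* From [y = b + s * p ^ be] and [2 * a = p ^ be * u], solving [u * x = s] makes [2 * a * x + b]
   congruent to [y]; cancelling the [p]-part of [4 * a] leaves a root modulo [p ^ e]. *)
have nosol y : (p%:Z ^+ al %| y ^+ 2 - (b ^+ 2 - 4 * a * c))%Z ->
    ~ (p%:Z ^+ be %| y - b)%Z.
  move=> yd /dvdzP[s sE]; apply: no_local.
  have [u aE pu] := multiplicityP pp a20; rewrite -/be in aE.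
  have [x xE] := linear_solve s (coprime_prime_exp al pp pu).
  exists x; change (p%:Z ^+ e %| quad a b c x)%Z.
  have [v vE pv] := multiplicityP pp a40.
  have : (p%:Z ^+ al %| 4 * a * quad a b c x)%Z.
    rewrite quad_complete_square.
    have -> : (2 * a * x + b) ^+ 2 - (b ^+ 2 - 4 * a * c) =
      (y ^+ 2 - (b ^+ 2 - 4 * a * c)) +
      (u * x - s) * (p%:Z ^+ be * (2 * a * x + b + y)).
      have -> : (u * x - s) * (p%:Z ^+ be * (2 * a * x + b + y)) =
        (p%:Z ^+ be * u * x - s * p%:Z ^+ be) * (2 * a * x + b + y) by ring.
      by rewrite -aE -sE; ring.
    by rewrite rpredD // dvdz_mulr.
  rewrite alE exprD; move: vE; set t := multiplicity p (4 * a) => ->.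
  rewrite -mulrA (dvdz_mul2l (expz_neq0 _ pp)).
  by rewrite Gauss_dvdzr //; exact: coprime_prime_exp.
(* Otherwise [root_up_to_sign] would make [y0] or [- y0] congruent to [b] modulo [p ^ be], against
   [nosol]. *)
have extra : ~ (be = 1%N \/ ~~ (p%:Z %| b)%Z).
  move=> H.
  have : (p%:Z ^+ multiplicity p (4 * a) %| (y0 - b) * (y0 + b))%Z.
    have -> : (y0 - b) * (y0 + b) = (y0 ^+ 2 - (b ^+ 2 - 4 * a * c)) - 4 * a * c.
      by ring.
    apply: rpredB; last by apply: dvdz_mulr; rewrite dvdz_pfactor.
    by apply: dvdz_trans y0d; rewrite dvdz_exp2l // alE leq_addr.
  case/(root_up_to_sign pp a0 pa)/(_ H) => [|yb]; first exact: nosol.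
  apply: (nosol (- y0)); first by rewrite sqrrN.
  by rewrite -opprD dvdzN.
have be_gt1 : (1 < be)%N.
  have : (0 < be)%N by rewrite -dvdz_pfactor ?expr1.
  case: (be) extra => [|[|//]] // extra _.
  by case: extra; left.
have pb : (p%:Z %| b)%Z by apply: contraT => pb; case: extra; right.
split=> //.
- by rewrite be_gt1 alE; move: e_gt0 le_be; clear; lia.
- rewrite rpredB ?dvdz_exp2r // dvdz_mulr //.
  by rewrite dvdz_pfactor // (leq_trans be_gt1).
- exact: no_root_obstruction y0d nosol.
Qed.

End Reduction.

(** * Conditions (ii)-(iv) *)

(** Every [z] is [A * x + B] modulo [q], so an implication about values of [g] becomes one about
    [z ^+ 2 - E], as the rigidity lemmas require. At odd primes [w = 4 * a'] and [A = 2 * a']; at 2,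
    where [b'] is even, [w = A = a']. *)
Lemma square_residues_of_roots (q1 q r A B E w : int) (g : int -> int) :
  (q1 %| q)%Z -> coprimez q A -> coprimez q1 w ->
  (forall x, w * g x = (A * x + B) ^+ 2 - E) ->
  (forall x, (q1 %| r * g x)%Z -> (q %| g x)%Z) ->
  forall z, (q1 %| r * (z ^+ 2 - E))%Z -> (q %| z ^+ 2 - E)%Z.
Proof.
move=> q1q coA cow gE H z zE; have [x xq] := linear_solve (z - B) coA.
have wE : w * g x = (z ^+ 2 - E) + (A * x - (z - B)) * (A * x + B + z).
  by rewrite gE; ring.
have qd : (q %| (A * x - (z - B)) * (A * x + B + z))%Z by rewrite dvdz_mulr.
rewrite -(dvdzDr _ qd) -wE dvdz_mull // H // -(Gauss_dvdzr _ cow) mulrCA wE.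
by rewrite mulrDr dvdzDr // dvdz_mull // (dvdz_trans q1q).
Qed.

Lemma two_dvd_quad (A B C x : int) : ~~ (2 %| A)%Z -> ~~ (2 %| B)%Z ->
  (2 %| C)%Z -> (2 %| quad A B C x)%Z.
Proof.
move=> A2 B2 C2; have [s AE] : exists s, A = 2 * s + 1 by exists (A %/ 2)%Z;
  lia.
have [t BE] : exists t, B = 2 * t + 1 by exists (B %/ 2)%Z; lia.
have -> : quad A B C x = 2 * (s * x ^+ 2 + t * x) + x * (x + 1) + C.
  by rewrite /quad AE BE; ring.
have xx : (2 %| x * (x + 1))%Z.
  have [x2|x2] : (2 %| x)%Z \/ (2 %| x + 1)%Z by lia.
    exact: dvdz_mulr.
  exact: dvdz_mull.
by rewrite !rpredD // dvdz_mulr.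
Qed.

Lemma coprime_two_pow e (z : int) : ~~ (2 %| z)%Z -> coprimez (2 ^+ e) z.
Proof. exact: (@coprime_prime_exp 2 e z isT). Qed.

(** * From (ii)-(iv) to solvability and lifting *)

Section Lifting.

Variables (a b c n r a' b' c' m : int) (k : nat).
Hypothesis red : reduction a n r a' m k.
Hypotheses (bE : b = r * b') (cE : c = r * c').

Let M := reduced_modulus k m.
Let D := b' ^+ 2 - 4 * a' * c'.

Lemma red_r_neq0 : r != 0. Proof. by case: red => _ _ []. Qed.

Lemma quad_factor x : quad a b c x = r * quad a' b' c' x.
Proof. by case: red => -> _ _ _ _; rewrite bE cE /quad; ring. Qed.

Lemma disc_factor : b ^+ 2 - 4 * a * c = D * r ^+ 2.
Proof. by case: red => -> _ _ _ _; rewrite bE cE /D; ring. Qed.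

Lemma disc_quotient : ((b ^+ 2 - 4 * a * c) %/ r ^+ 2)%Z = D.
Proof. by rewrite disc_factor mulzK // expf_neq0 // red_r_neq0. Qed.

Lemma red_dvd_n x : (n %| quad a b c x)%Z = (2 ^+ k * m %| quad a' b' c' x)%Z.
Proof.
rewrite quad_factor; case: red => _ -> [r0 _] _ _.
by rewrite [_ * r]mulrC dvdz_mul2l.
Qed.

Lemma coprime_m_2a' : coprimez m (2 * a').
Proof.
move: (coprime_m_4a' red); have -> : 4 * a' = 2 * (2 * a') by ring.
by rewrite coprimezMr => /andP[].
Qed.

Lemma m_root : quadratic_residue D m -> exists x, (m %| quad a' b' c' x)%Z.
Proof. exact: quad_root coprime_m_2a'. Qed.

Lemma m_lift x : delta_condition (gcdz m r) m D ->
  (m %| quad a b c x)%Z -> (m %| quad a' b' c' x)%Z.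
Proof.
have m0 := red_m_neq0 red.
move/(delta_condition_local _ _ m0 (red_m_odd red)) => H.
rewrite quad_factor; exact: quad_lift m0 (coprime_m_4a' red) H.
Qed.

Lemma condition_ii_lift : condition_ii b c (b ^+ 2 - 4 * a * c) r m (gcdz m r) k ->
  (exists x, (M %| quad a b c x)%Z) /\
  (forall x, (M %| quad a b c x)%Z -> (n %| quad a b c x)%Z).
Proof.
rewrite /condition_ii disc_quotient => -[k0 _ qr dc].
have -> : M = m by rewrite /M /reduced_modulus k0.
split=> [|x mx].
  by have [x mx] := m_root qr; exists x; rewrite quad_factor dvdz_mull.
by rewrite red_dvd_n k0 expr0 mul1r m_lift.
Qed.

(** For [k = 1] an extra factor 2 is to be gained: [a'] is odd, being prime to [n / r], so [c'] is
    the even one and the quadratic takes only even values. *)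
Lemma condition_iii_lift : condition_iii a b c (b ^+ 2 - 4 * a * c) r m (gcdz m r) k ->
  (exists x, (M %| quad a b c x)%Z) /\
  (forall x, (M %| quad a b c x)%Z -> (n %| quad a b c x)%Z).
Proof.
rewrite /condition_iii disc_quotient => -[k1 _ [b2 ac2] qr dc].
have r0 := red_r_neq0.
have MM : M = m by rewrite /M /reduced_modulus k1.
rewrite MM; split=> [|x mx].
  by have [x mx] := m_root qr; exists x; rewrite quad_factor dvdz_mull.
have a'2 : ~~ (2 %| a')%Z by apply: (red_a'_odd red); rewrite k1.
rewrite red_dvd_n k1 expr1 Gauss_dvdz; last first.
  by have := coprime_m_4 red; rewrite (_ : 4 = 2 ^+ 2) // coprimez_pexpr //
    coprimez_sym.
rewrite m_lift // andbT; move: b2 ac2.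
case: red => -> _ _ _ _; rewrite bE cE !(mulrC r) !mulzK //.
by move=> b2 [a2|c2]; [rewrite a2 in a'2 | exact: two_dvd_quad].
Qed.

(** With [k = K.+3], [b' = 2 * B] and [D = 2 ^+ K.+2 * u], the quadratic becomes a square minus
    [2 ^+ K * u], to which [two_lift] applies; [r] is odd and cancels. *)
Lemma condition_iv_lift : condition_iv b c (b ^+ 2 - 4 * a * c) r m (gcdz m r) k ->
  (exists x, (M %| quad a b c x)%Z) /\
  (forall x, (M %| quad a b c x)%Z -> (n %| quad a b c x)%Z).
Proof.
rewrite /condition_iv disc_quotient => -[k3 [r2 ok] _ [D0 mD uE] [qr dc]].
have r0 := red_r_neq0; have a'2 := red_a'_odd red (ltnW (ltnW k3)).
have [K kE] : exists K, k = K.+3 by exists (k - 3)%N; rewrite -addn3 subnK.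
have eK : ~~ odd K by move: ok; rewrite kE /= negbK.
have ME : M = 2 ^+ K.+1 * m.
  by rewrite /M /reduced_modulus leqNgt k3 /= kE subn2.
have [u DE u2] := multiplicityP (isT : prime 2) D0.
rewrite mD kE /= in DE.
have u8 : (8 %| u - 1)%Z.
  apply/eqmodz_dvd; rewrite -uE disc_factor DE kE /=.
  have -> : 2 ^+ K.+2 * u * r ^+ 2 = u * (r ^+ 2 * 2 ^+ K.+2) by ring.
  by rewrite mulzK // mulf_neq0 ?expf_neq0.
have [B BE] : exists B, b' = 2 * B.
  have : (2 %| b' ^+ 2)%Z.
    have -> : b' ^+ 2 = D + 2 * (2 * a' * c') by rewrite /D; ring.
    by rewrite rpredD ?dvdz_mulr // DE (exprS 2) -mulrA dvdz_mulr.
  rewrite expr2 [(_ %| _)%Z](dvdz_prime_mul _ _ (isT : prime 2)) orbb.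
  by case/dvdzP => B ->; exists B; rewrite mulrC.
have sq x : a' * quad a' b' c' x = (a' * x + B) ^+ 2 - 2 ^+ K * u.
  have EE : B ^+ 2 - a' * c' = 2 ^+ K * u.
    apply: (mulfI (isT : (4 : int) != 0)); rewrite mulrBr.
    transitivity D; first by rewrite /D BE; ring.
    by rewrite DE !(exprS 2); ring.
  by rewrite -EE /quad BE; ring.
split=> [|x Mx].
  have [x1 mx1] := m_root qr.
  (* Since [K] is even and [u] odd, [2 ^+ K./2] is a square root of [2 ^+ K * u] modulo
     [2 ^+ K.+1]. *)
  have [x2 x2E] := linear_solve (2 ^+ K./2 - B) (coprime_two_pow K.+1 a'2).
  have [x [x_2 x_m]] := chinese_dvd x2 x1 (coprime_two_pow K.+1 (red_m_odd red)).
  exists x; rewrite ME quad_factor dvdz_mull // Gauss_dvdz; last first.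
    exact: coprime_two_pow (red_m_odd red).
  rewrite (congr_fun_dvd (@congr_quad a' b' c') x_2).
  rewrite (congr_fun_dvd (@congr_quad a' b' c') x_m) mx1 andbT.
  rewrite -(Gauss_dvdzr _ (coprime_two_pow K.+1 a'2)) sq.
  set y := 2 ^+ K./2 in x2E.
  have -> : (a' * x2 + B) ^+ 2 - 2 ^+ K * u =
    (a' * x2 - (y - B)) * (a' * x2 + B + y) - 2 ^+ K * (u - 1).
    have -> : 2 ^+ K = y ^+ 2 by rewrite /y -exprM muln2 even_halfK.
    by ring.
  apply: rpredB; first exact: dvdz_mulr.
  by rewrite (exprSr 2 K); apply: dvdz_mul => //; apply: dvdz_trans u8.
have mx : (m %| quad a' b' c' x)%Z.
  by apply: m_lift => //; apply: dvdz_trans Mx; rewrite ME dvdz_mull.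
rewrite red_dvd_n Gauss_dvdz ?mx ?andbT;
  last exact: coprime_two_pow (red_m_odd red).
rewrite -(Gauss_dvdzr _ (coprime_two_pow k a'2)) sq kE; apply: two_lift => //.
rewrite -sq dvdz_mull //
  -(Gauss_dvdzr _ (coprime_two_pow K.+1 r2)) -quad_factor.
by apply: dvdz_trans Mx; rewrite ME dvdz_mulr.
Qed.

End Lifting.

(** * From lifting to (ii)-(iv) *)

Section Rigidity.

Variables (a b c n r a' m : int) (k : nat).
Hypothesis red : reduction a n r a' m k.

Let M := reduced_modulus k m.

Variable x0 : int.
Hypothesis x0M : (M %| quad a b c x0)%Z.
Hypothesis lift : forall x, (M %| quad a b c x)%Z -> (n %| quad a b c x)%Z.

Lemma modulus_index : 2 ^+ k * m = 2 ^+ minn k 2 * M.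
Proof.
have [k2|k2] := leqP k 2; first by rewrite /M /reduced_modulus k2.
exact: modulus_four.
Qed.

(** Here [s] is a sign. The point [x0 + s * M] is again a root modulo [M], hence modulo [n];
    subtracting the values at the two points and cancelling [M] gives the claim. *)
Lemma rigid_step s : s * s = 1 ->
  (2 ^+ minn k 2 * r %| 2 * a * x0 + b + s * a * M)%Z.
Proof.
move=> ss; have M0 := red_M_neq0 red.
have E : quad a b c (x0 + s * M) - quad a b c x0 =
    M * (s * (2 * a * x0 + b + s * a * M)) by rewrite /quad; ring.
have : (n %| quad a b c (x0 + s * M) - quad a b c x0)%Z.
  rewrite rpredB ?lift //
    -[quad _ _ _ (_ + _)](subrK (quad a b c x0)) rpredD //.
  by rewrite E dvdz_mulr.
case: red => _ -> _ _ _; rewrite E modulus_index.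
have -> : 2 ^+ minn k 2 * M * r = M * (2 ^+ minn k 2 * r) by ring.
rewrite dvdz_mul2l // => H.
by have := dvdz_mull s H; rewrite mulrA ss mul1r.
Qed.

Lemma rigid_r : (r %| b)%Z /\ (r %| c)%Z.
Proof.
have ra : (r %| a)%Z by case: red => -> _ _ _ _; rewrite dvdz_mulr.
have rb : (r %| b)%Z.
  have : (r %| 2 * a * x0 + b + 1 * a * M)%Z.
    by apply: dvdz_trans (rigid_step (mul1r 1)); rewrite dvdz_mull.
  rewrite dvdzDr; last by rewrite dvdz_mulr // dvdz_mull.
  by rewrite dvdzDl // dvdz_mulr // dvdz_mull.
split=> //; have : (r %| quad a b c x0)%Z.
  apply: dvdz_trans (lift x0M); case: red => _ -> _ _ _; exact: dvdz_mull.
by rewrite /quad dvdzDl // rpredD // dvdz_mulr.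
Qed.

Variables b' c' : int.
Hypotheses (bE : b = r * b') (cE : c = r * c').

Let D := b' ^+ 2 - 4 * a' * c'.

Lemma rigid_step' s : s * s = 1 ->
  (2 ^+ minn k 2 %| 2 * a' * x0 + b' + s * a' * M)%Z.
Proof.
move=> ss; have := rigid_step ss; case: red => -> _ [r0 _] _ _; rewrite bE.
have -> : 2 * (r * a') * x0 + r * b' + s * (r * a') * M =
  (2 * a' * x0 + b' + s * a' * M) * r by ring.
by rewrite dvdz_mul2r.
Qed.

Lemma root_N : (2 ^+ k * m %| quad a' b' c' x0)%Z.
Proof. by rewrite -(red_dvd_n red bE cE) lift. Qed.

Lemma root_disc : (2 ^+ k * m %| (2 * a' * x0 + b') ^+ 2 - D)%Z.
Proof. by rewrite -quad_complete_square dvdz_mull // root_N. Qed.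

Lemma rigid_residue : quadratic_residue D m.
Proof.
exists (2 * a' * x0 + b'); apply/eqmodz_dvd.
by apply: dvdz_trans root_disc; rewrite dvdz_mull.
Qed.

Lemma rigid_local p x : prime p ->
  (p%:Z ^+ multiplicity p M %| r * quad a' b' c' x)%Z ->
  (p%:Z ^+ multiplicity p (2 ^+ k * m) %| quad a' b' c' x)%Z.
Proof.
apply: (@localize (quad a' b' c') M _ r x0 (congr_quad _ _ _)).
- exact: red_M_neq0 red.
- exact: red_N_neq0 red.
- exact: modulus_dvd.
- by rewrite -(quad_factor red bE cE).
- by move=> y; rewrite -(quad_factor red bE cE) -(red_dvd_n red bE cE);
  exact: lift.
Qed.

Lemma odd_multiplicity p : prime p -> p != 2%N ->
  multiplicity p M = multiplicity p m /\
  multiplicity p (2 ^+ k * m) = multiplicity p m.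
Proof.
move=> pp p2; have m0 := red_m_neq0 red.
have mul2 j : multiplicity p (2 ^+ j) = 0%N.
  by rewrite multiplicityX /multiplicity lognE /= dvdn_prime2 //
    (negbTE p2) andbF muln0.
split; last by rewrite multiplicityM ?expf_neq0 // mul2.
by rewrite /M /reduced_modulus; case: ifP => // _;
  rewrite multiplicityM ?expf_neq0 // mul2.
Qed.

(** At an odd prime [M], [2 ^+ k * m] and [m] have equal multiplicities, so the local implication
    has the shape that [odd_prime_rigid] asks for. *)
Lemma rigid_delta : delta_condition (gcdz m r) m D.
Proof.
have m0 := red_m_neq0 red; have m2 := red_m_odd red.
apply/(delta_condition_local _ _ m0 m2) => p pp pm pr.
have op : odd p.
  by apply: contraNT m2 => /(prime_oddPn pp) p2; move: pm; rewrite p2.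
have p2 : p != 2%N by apply: contraTneq op => ->.
have [eM eN] := odd_multiplicity pp p2.
have co e : coprimez (p%:Z ^+ e) (4 * a').
  by apply: coprime_prime_exp => //; apply: coprime_not_dvd (coprime_m_4a' red).
have co2 e : coprimez (p%:Z ^+ e) (2 * a').
  by apply: coprime_prime_exp => //; apply: coprime_not_dvd (coprime_m_2a' red).
apply: (odd_prime_rigid (z0 := 2 * a' * x0 + b')) => //.
- by rewrite -dvdz_pfactor ?expr1.
- apply: (square_residues_of_roots (dvdzz _) (co2 _) (co _)
    (quad_complete_square a' b' c')).
  by move=> x; have := @rigid_local p x pp; rewrite eM eN.
- apply: dvdz_trans root_disc; rewrite dvdz_pfactor ?(red_N_neq0 red) //.
  by rewrite eN.
Qed.

Lemma two_multiplicity (e : nat) : multiplicity 2 (2 ^+ e * m) = e.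
Proof.
have m0 := red_m_neq0 red.
rewrite multiplicityM ?expf_neq0 // multiplicityX muln1.
suff -> : multiplicity 2 m = 0%N by rewrite addn0.
apply/eqP; rewrite eqn0Ngt -(dvdz_pfactor _ (isT : prime 2)) // expr1.
exact: red_m_odd red.
Qed.

Lemma rigid_conditions :
  [\/ condition_ii b c (b ^+ 2 - 4 * a * c) r m (gcdz m r) k,
      condition_iii a b c (b ^+ 2 - 4 * a * c) r m (gcdz m r) k |
      condition_iv b c (b ^+ 2 - 4 * a * c) r m (gcdz m r) k].
Proof.
rewrite /condition_ii /condition_iii /condition_iv (disc_quotient red bE cE) -/D.
have qr := rigid_residue; have dc := rigid_delta; have rbc := rigid_r.
have m2 := red_m_odd red; have r0 := red_r_neq0 red.
have [k0|k_gt0] := posnP k; first by apply: Or31.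
have a'2 := red_a'_odd red k_gt0.
have am2 : ~~ (2 %| a' * m)%Z.
  by rewrite [(_ %| _)%Z](dvdz_prime_mul _ _ (isT : prime 2)) negb_or a'2.
have stepP := @rigid_step' 1 (mul1r 1).
have stepN := @rigid_step' (-1) (mulrNN 1 1).
have [k_le2|k_gt2] := leqP k 2; last first.
  apply: Or33; move: stepP; rewrite (minn_idPr _) 1?ltnW // => stepP.
  have [K kE] : exists K, k = K.+3 by exists (k - 3)%N; rewrite -addn3 subnK.
  have ME : M = 2 ^+ K.+1 * m.
    by rewrite /M /reduced_modulus leqNgt k_gt2 /= kE subn2.
  (* In [stepP] every term other than [b'] is even, because [M] is. *)
  have [B BE] : exists B, b' = 2 * B.
    have : (2 %| 2 * a' * x0 + b' + 1 * a' * M)%Z by apply: dvdz_trans stepP.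
    rewrite dvdzDr; last by rewrite dvdz_mull // ME (exprS 2) -mulrA dvdz_mulr.
    rewrite dvdzDl; last by rewrite -mulrA dvdz_mulr.
    by case/dvdzP => B ->; exists B; rewrite mulrC.
  have sq x : a' * quad a' b' c' x = (a' * x + B) ^+ 2 - (B ^+ 2 - a' * c').
    by rewrite /quad BE; ring.
  have DE : D = 4 * (B ^+ 2 - a' * c') by rewrite /D BE; ring.
  have co e : coprimez (2 ^+ e) a' by exact: coprime_two_pow.
  have [||eK r2 [u EE u8]] := @two_rigid K r (B ^+ 2 - a' * c') (a' * x0 + B).
  - apply: (square_residues_of_roots _ (co _) (co _) sq).
      by rewrite dvdz_exp2l // !ltnS leqW.
    move=> x; have := @rigid_local 2 x isT.
    by rewrite ME !two_multiplicity kE.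
  - by rewrite -sq dvdz_mull //; apply: dvdz_trans root_N; rewrite kE dvdz_mulr.
  have DE2 : D = 2 ^+ K.+2 * u by rewrite DE EE !(exprS 2); ring.
  have u2 : ~~ (2 %| u)%Z.
    apply/negP => u2; have : (2 %| u - 1)%Z by apply: dvdz_trans u8.
    by rewrite [(_ %| _)%Z](dvdzDl _ u2).
  have u0 : u != 0 by apply: contraNneq u2 => ->.
  split=> //; first by rewrite kE /= negbK.
  rewrite kE /=; split.
  - by rewrite DE2 mulf_neq0 // expf_neq0.
  - rewrite DE2 multiplicityM ?expf_neq0 // multiplicityX muln1.
    suff -> : multiplicity 2 u = 0%N by rewrite addn0.
    by apply/eqP; rewrite eqn0Ngt -(dvdz_pfactor _ (isT : prime 2)) // expr1.
  - rewrite (disc_factor red bE cE) -/D DE2.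
    have -> : 2 ^+ K.+2 * u * r ^+ 2 = u * (r ^+ 2 * 2 ^+ K.+2) by ring.
    rewrite mulzK; first exact/eqmodz_dvd.
    by apply: mulf_neq0; rewrite expf_neq0.
move: stepP stepN; rewrite (minn_idPl k_le2) /M /reduced_modulus k_le2.
have [k1|k2] : k = 1%N \/ k = 2%N by move: k_gt0 k_le2; clear; lia.
  rewrite k1 expr1 => stepP _; apply: Or32; split=> //.
  (* For [k = 1], [stepP] says that [b' + a' * m] is even, while [a' * m] is odd. *)
  have b'2 : ~~ (2 %| b')%Z.
    apply: contra am2 => b2; move: stepP; rewrite mul1r dvdzDl //.
    by rewrite rpredD // -mulrA dvdz_mulr.
  case: red => -> _ _ _ _;
    rewrite [in (b %/ r)%Z]bE [in (c %/ r)%Z]cE !(mulrC r) !mulzK //.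
  split=> //; right; have c'E : c' = quad a' b' c' x0 - quad a' b' 0 x0.
    by rewrite /quad; ring.
  rewrite c'E; apply: rpredB; last exact: two_dvd_quad.
  by apply: dvdz_trans root_N; rewrite k1 dvdz_mulr.
(* For [k = 2] the steps in the two directions differ by [2 * (a' * m)], which would be divisible by
   4. *)
rewrite k2 => stepP stepN; case/negP: am2.
rewrite -(dvdz_mul2l (isT : (2 : int) != 0)).
have -> : 2 * (a' * m) = (2 * a' * x0 + b' + 1 * a' * m) -
  (2 * a' * x0 + b' + -1 * a' * m) by ring.
exact: rpredB.
Qed.

End Rigidity.

(** * The decomposition of n, and the theorem *)

Lemma gcd_reduction (a n r m : int) (k : nat) : n != 0 -> a != 0 ->
  r = gcdz a n -> k = multiplicity 2 (n %/ r)%Z -> m = (n %/ (2 ^+ k * r))%Z ->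
  reduction a n r (a %/ r)%Z m k.
Proof.
move=> n0 a0 rE kE mE.
have r0 : r != 0 by rewrite rE gcdz_eq0 negb_and a0.
have aE : a = r * (a %/ r)%Z by rewrite mulrC divzK // rE dvdz_gcdl.
have nE : n = r * (n %/ r)%Z by rewrite mulrC divzK // rE dvdz_gcdr.
have N0 : (n %/ r)%Z != 0 by apply: contraNneq n0 => N0; rewrite nE N0 mulr0.
have a'0 : (a %/ r)%Z != 0 by apply: contraNneq a0 => a'0; rewrite aE a'0 mulr0.
have [w NE w2] := multiplicityP (isT : prime 2) N0; rewrite -kE in NE.
have w0 : w != 0 by apply: contraNneq w2 => ->.
have nE2 : n = 2 ^+ k * w * r by rewrite nE NE mulrC.
have mw : m = w.
  have E : n = w * (2 ^+ k * r) by rewrite nE2; ring.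
  by rewrite mE E mulzK // mulf_neq0 // expf_neq0.
rewrite mw; split=> //.
have [u [v uvE]] := Bezoutz a n.
apply/coprimezP; exists (v, u); apply: (mulfI r0); rewrite mulr1 /=.
have -> : r * (v * (2 ^+ k * w) + u * (a %/ r)%Z) =
  u * (r * (a %/ r)%Z) + v * (2 ^+ k * w * r) by ring.
by rewrite -aE -nE2 uvE -rE.
Qed.

Lemma exactly_one_exists (Cs : seq Prop) : mutually_exclusive Cs ->
  exactly_one Cs <-> exists i, nth False Cs i.
Proof.
move=> ex; split=> [[i [Ci _]]|[i Ci]]; exists i => //.
by split=> // j; exact: ex.
Qed.

Theorem theorem6p1 (a b c n : int) (hn : 2 <= n) (ha : ~~ (n %| a)%Z)
  (r : int) (hr : r = gcdz a n)
  (k : nat) (hk : k = multiplicity 2 (n %/ r)%Z)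
  (m : int) (hm : m = (n %/ (2 ^+ k * r))%Z)
  (delta : int) (hdelta : delta = gcdz m r)
  (d : int) (hd : d = b ^+ 2 - 4 * a * c) :
  let conditions :=
    [:: condition_i a b d m k;
        condition_ii b c d r m delta k;
        condition_iii a b c d r m delta k;
        condition_iv b c d r m delta k] in
  mutually_exclusive conditions /\
  (IQF_valid a b c n <->
     quadratic_nonresidue d n \/
     (quadratic_residue d n /\ exactly_one conditions)).
Proof.
move=> conditions.
have n0 : n != 0 by apply: contraTneq hn => ->.
have a0 : a != 0 by apply: contraNneq ha => ->; rewrite dvdz0.
have red := gcd_reduction n0 a0 hr hk hm.
set M := reduced_modulus k m.
have no_root : condition_i a b d m k -> forall x, ~ (M %| quad a b c x)%Z.
  by rewrite hd => Ci x; apply: (condition_i_no_root red).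
have late i : nth False conditions i.+1 ->
    [\/ condition_ii b c d r m delta k, condition_iii a b c d r m delta k |
        condition_iv b c d r m delta k].
  by case: i => [|[|[|i]]] //= C; [exact: Or31 | exact: Or32 | exact: Or33 |
    move: C; rewrite nth_nil].
(* Among (ii)-(iv) the value of [k] decides which one can hold, so no two hold together. *)
have index_k i : nth False conditions i.+1 -> i = minn k 2.
  case: i => [|[|[|i]]] /=; last by rewrite nth_nil.
  - by case=> ->.
  - by case=> ->.
  - by case=> k3 *; rewrite (minn_idPr (ltnW k3)).
have lifts i : nth False conditions i.+1 ->
    (exists x, (M %| quad a b c x)%Z) /\
    (forall x, (M %| quad a b c x)%Z -> (n %| quad a b c x)%Z).
  move/late; rewrite hd hdelta => C.
  have [/dvdzP[b' bE] /dvdzP[c' cE]] : (r %| b)%Z /\ (r %| c)%Z.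
    by case: C => -[].
  rewrite mulrC in bE; rewrite mulrC in cE.
  case: C => C.
  - exact: (condition_ii_lift red bE cE C).
  - exact: (condition_iii_lift red bE cE C).
  - exact: (condition_iv_lift red bE cE C).
(* Conditions (ii)-(iv) provide a root modulo [M], which (i) forbids. *)
have late_not_i i : nth False conditions i.+1 -> ~ condition_i a b d m k.
  by move=> /lifts[[x Mx] _] /no_root/(_ x).
have excl : mutually_exclusive conditions.
  move=> [|i] [|j] // Ci Cj; first by case: (late_not_i _ Cj).
    by case: (late_not_i _ Ci).
  by rewrite (index_k _ Ci) (index_k _ Cj).
split=> //; rewrite exactly_one_exists // (IQF_valid_modulus b c red) -/M.
split=> [valid|[nonres x Mx|[_ [[|i] Ci]] x Mx]].
- have [res|nonres] := classic (quadratic_residue d n); [right | by left].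
  split=> //;
    have [[x0 Mx0]|noroot] := classic (exists x, (M %| quad a b c x)%Z).
    have [/dvdzP[b' bE] /dvdzP[c' cE]] := rigid_r red Mx0 valid.
    rewrite mulrC in bE; rewrite mulrC in cE.
    have := rigid_conditions red Mx0 valid bE cE; rewrite -hd -hdelta.
    by case=> C; [exists 1%N | exists 2%N | exists 3%N].
  exists 0%N => /=; rewrite hd; apply: (no_root_condition_i red).
    by rewrite -hd.
  by move=> x Mx; apply: noroot; exists x.
(* A root [x] modulo [M] would make [2 * a * x + b] a square root of [d] modulo [n]. *)
- case: nonres; exists (2 * a * x + b); apply/eqmodz_dvd.
  by rewrite hd -quad_complete_square (red_dvd4 red).
- by case: (no_root Ci x Mx).
- by have [_] := lifts i Ci; apply.
Qed.
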